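(* Let $G$ be a graph having neither an induced $C_4$ nor an induced $C_5$. Then $G\in \mathcal{F}(\vec{\mathcal{P}})$ if and only if $G$ is a comb.
   Context: Graphs and digraphs are finite; graphs are simple. An oriented graph is a digraph without loops, parallel arcs or digons (directed cycles of length 2). For a vertex $v$ of an oriented graph $D$, $N^{+}(v)$ is the set of out-neighbors of $v$, and $N^{++}(v)$ is the set of vertices at distance exactly 2 from $v$ (out-neighbors of out-neighbors of $v$, excluding $N^{+}(v)$). Write $x\rightarrow y$ if $(x,y)\in E(D)$. A missing edge of $D$ is an unordered pair $xy$ of distinct vertices with $(x,y)\notin E(D)$ and $(y,x)\notin E(D)$. $D$ is missing a graph $G$ if $V(G)\subseteq V(D)$ and $E(G)$ is exactly the set of missing edges of $D$ (isolated vertices of $G$ are allowed). A missing edge $e$ loses to a missing edge $e'$ if their endpoints can be labelled $e=x_1y_1$, $e'=x_2y_2$ so that $x_1\rightarrow x_2$, $y_2\notin N^{+}(x_1)\cup N^{++}(x_1)$, $y_1\rightarrow y_2$ and $x_2\notin N^{+}(y_1)\cup N^{++}(y_1)$. The dependency digraph $\Delta_D$ of $D$ has the missing edges of $D$ as vertices, with an arc $(e,e')$ if and only if $e$ loses to $e'$ (digons may occur in $\Delta_D$). For a family $\mathcal{H}$ of digraphs (digons allowed, taken up to isomorphism), $\mathcal{F}(\mathcal{H})$ is the set of graphs $G$ such that $\Delta_D\in\mathcal{H}$ for every oriented graph $D$ missing $G$. $\vec{\mathcal{P}}$ is the family of all digraphs consisting of vertex-disjoint directed paths only (a single vertex counts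 as a directed path; the digraph with no vertices is included). A chair is a graph on 5 distinct vertices $x,y,z,t,v$ whose edges are exactly $xy,yz,zt,zv$; the co-chair is its complement. $C_n$ is the cycle on $n$ vertices and $\overline{H}$ is the complement of $H$. A comb is a graph having no induced subgraph isomorphic to $C_4$, $\overline{C_4}$, $C_5$, chair or co-chair. *)

(* Defs.v *)
From mathcomp Require Import all_boot.
Set Implicit Arguments.
Unset Strict Implicit.
Unset Printing Implicit Defensive.

Record sgraph := SGraph {
  svertex :> finType;
  edge : rel svertex;
  edge_sym : symmetric edge;
  edge_irrefl : irreflexive edge }.
Arguments edge {s} x y.

Definition sgraph_iso (G H : sgraph) : Prop :=
  exists2 f : G -> H, bijective f & forall x y : G, edge (f x) (f y) = edge x y.

Section Induced.
Variables (G : sgraph) (S : {set G}).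

Definition induced_edge : rel {x : G | x \in S} :=
  fun x y => edge (val x) (val y).

Lemma induced_edge_sym : symmetric induced_edge.
Proof. by move=> x y; rewrite /induced_edge edge_sym. Qed.

Lemma induced_edge_irrefl : irreflexive induced_edge.
Proof. by move=> x; rewrite /induced_edge edge_irrefl. Qed.

Definition induced : sgraph := SGraph induced_edge_sym induced_edge_irrefl.
End Induced.

Definition has_induced (H G : sgraph) : Prop :=
  exists S : {set G}, sgraph_iso (induced S) H.

Section Complement.
Variable G : sgraph.

Definition compl_edge : rel G := fun x y => (x != y) && ~~ edge x y.

Lemma compl_edge_sym : symmetric compl_edge.
Proof. by move=> x y; rewrite /compl_edge eq_sym edge_sym. Qed.

Lemma compl_edge_irrefl : irreflexive compl_edge.
Proof. by move=> x; rewrite /compl_edge eqxx. Qed.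

Definition compl : sgraph := SGraph compl_edge_sym compl_edge_irrefl.
End Complement.

Section Cycle.
Variable n : nat.

(* [ordS] is the cyclic successor.  The conjunct [i != j] only matters for
   n = 1; this is the cycle on n vertices for n >= 3. *)
Definition cycle_edge : rel 'I_n :=
  fun i j => (i != j) && ((j == ordS i) || (i == ordS j)).

Lemma cycle_edge_sym : symmetric cycle_edge.
Proof. by move=> i j; rewrite /cycle_edge eq_sym orbC. Qed.

Lemma cycle_edge_irrefl : irreflexive cycle_edge.
Proof. by move=> i; rewrite /cycle_edge eqxx. Qed.

Definition cycle_graph : sgraph := SGraph cycle_edge_sym cycle_edge_irrefl.
End Cycle.

(* x, y, z, t, v are numbered 0, 1, 2, 3, 4. *)
Definition chair_edges : seq (nat * nat) :=
  [:: (0, 1); (1, 2); (2, 3); (2, 4)].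

Definition chair_edge : rel 'I_5 := fun i j =>
  ((val i, val j) \in chair_edges) || ((val j, val i) \in chair_edges).

Lemma chair_edge_sym : symmetric chair_edge.
Proof. by move=> i j; rewrite /chair_edge orbC. Qed.

Lemma chair_edge_irrefl : irreflexive chair_edge.
Proof. by case; do 5?case. Qed.

Definition chair : sgraph := SGraph chair_edge_sym chair_edge_irrefl.
Definition cochair : sgraph := compl chair.

Definition comb (G : sgraph) : Prop :=
  [/\ ~ has_induced (cycle_graph 4) G,
      ~ has_induced (compl (cycle_graph 4)) G,
      ~ has_induced (cycle_graph 5) G,
      ~ has_induced chair G &
      ~ has_induced cochair G].

Record digraph := Digraph {
  dvertex :> finType;
  arc : rel dvertex }.
Arguments arc {d} x y.

Record oriented_graph := OrientedGraph {
  odigraph :> digraph;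
  oarc_irrefl : irreflexive (@arc odigraph);
  oarc_nodigon : forall x y : odigraph, arc x y -> ~~ arc y x }.

Section Dependency.
Variable D : oriented_graph.

Definition out_nbr (v : D) : {set D} := [set w | arc v w].

(* v itself is not in this set, since D has no digons. *)
Definition out_nbr2 (v : D) : {set D} :=
  (\bigcup_(u in out_nbr v) out_nbr u) :\: out_nbr v.

Definition missing : rel D :=
  fun x y => [&& x != y, ~~ arc x y & ~~ arc y x].

Definition missing_edge (e : {set D}) : bool :=
  [exists x, exists y, missing x y && (e == [set x; y])].

Definition loses (e e' : {set D}) : bool :=
  [exists x1, exists y1, exists x2, exists y2,
    [&& e == [set x1; y1], e' == [set x2; y2],
        arc x1 x2, y2 \notin out_nbr x1 :|: out_nbr2 x1,
        arc y1 y2 & x2 \notin out_nbr y1 :|: out_nbr2 y1]].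

Definition dependency : digraph :=
  @Digraph {e : {set D} | missing_edge e} (fun e e' => loses (val e) (val e')).
End Dependency.

(* The inclusion of V(G) in V(D) is represented by an injection. *)
Definition is_missing (D : oriented_graph) (G : sgraph) : Prop :=
  exists2 f : G -> D, injective f &
    forall u v : D,
      missing u v <-> exists x y : G, [/\ f x = u, f y = v & edge x y].

(* Families of digraphs up to isomorphism are isomorphism-invariant
   predicates; [directed_paths] is one. *)
Definition forcing (H : digraph -> Prop) (G : sgraph) : Prop :=
  forall D : oriented_graph, is_missing D G -> H (dependency D).

(* s lists the paths, each given by its sequence of vertices in order;
   [infix [:: x; y] p] says that y comes immediately after x in p. *)
Definition directed_paths (H : digraph) : Prop :=
  exists s : seq (seq H),
    [/\ [::] \notin s, uniq (flatten s), forall x : H, x \in flatten s &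
        forall x y : H, arc x y <-> exists2 p, p \in s & infix [:: x; y] p].

(* Main.v *)
From Pilot Require (* [path] also defines an [arc]. *)
Import Defs.
From mathcomp Require Import all_boot.
Import Defs.
Set Implicit Arguments.
Unset Strict Implicit.
Unset Printing Implicit Defensive.

(** If [G] has no induced C4, co-C4 or C5, then a missing edge [e] can lose to
[e'] only when they are the end edges ab and cd of an induced path a-b-c-d of
[G].  In such a graph the ends of induced 4-vertex paths are pairwise
nonadjacent.  Without chairs and co-chairs, losing to two different edges, say
cd and c'd', forces c ~ c' and d, c' nonadjacent, and then any orientation of
dc' creates a forbidden directed path of length 2; reversing all arcs of [D]
gives the same bound for in-degrees.  Along a walk of losing edges with outer
ends a_0, a_1, a_2, ..., the arc a_1 -> a_0 propagates to a_k -> a_0 for all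
k >= 1, since a_k -> a_0 -> a_(k+1) is forbidden; so no walk is closed.

Conversely, an induced co-C4, chair or co-chair of [G] can be oriented, with all
other vertices dominating it, so that two missing edges lose to each other, or
one missing edge loses to two others. *)

(** * Disjoint unions of directed paths *)

Lemma uniq_flatten_mem (T : eqType) (s : seq (seq T)) (p : seq T) :
  uniq (flatten s) -> p \in s -> uniq p.
Proof.
elim: s => //= r s IHs; rewrite cat_uniq inE => /and3P[ur _ us].
by case/predU1P=> [->|]; last exact: IHs.
Qed.

Lemma uniq_flatten_inj (T : eqType) (s : seq (seq T)) (p q : seq T) (x : T) :
  uniq (flatten s) -> p \in s -> q \in s -> x \in p -> x \in q -> p = q.
Proof.
elim: s => //= r s IHs; rewrite cat_uniq => /and3P[_ /hasPn dis us].
have out t : t \in s -> x \in t -> x \in r -> False.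
  by move=> ts xt; apply/negP/dis/flattenP; exists t.
rewrite !inE => /predU1P[->|ps] /predU1P[->|qs] xp xq //.
- by case: (out q).
- by case: (out p).
- exact: IHs.
Qed.

Lemma index_infix2 (T : eqType) (x y : T) (p : seq T) :
  uniq p -> infix [:: x; y] p ->
  [/\ x \in p, y \in p & index y p = (index x p).+1].
Proof.
move=> up /infixP[l [r def_p]]; move: up; rewrite {p}def_p /=.
rewrite cat_uniq /= !inE !negb_or -!andbA.
case/and5P=> _ xl yl _ /andP[xy _].
rewrite !mem_cat !inE !eqxx !orbT; split=> //.
by rewrite !index_cat (negPf xl) (negPf yl) /= eqxx (negPf xy) eqxx addn0 addn1.
Qed.

(** The lists are disjoint and repetition-free, so an arc stays in one list and raises the index
    there by exactly one. Two out-neighbors thus share an index, and a digon would raise it in both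
    directions. Only these two consequences are needed to refute membership in the family. *)
Lemma directed_paths_arc (H : digraph) :
  directed_paths H ->
  (forall x y z : H, arc x y -> arc x z -> y = z) /\
  (forall x y : H, arc x y -> ~~ arc y x).
Proof.
case=> s [_ us _ arcE].
have indexE (x y : H) : arc x y ->
    exists p, [/\ p \in s, x \in p, y \in p & index y p = (index x p).+1].
  case/arcE=> p ps xyp; exists p.
  by have [] := index_infix2 (uniq_flatten_mem us ps) xyp.
split=> [x y z /indexE[p [ps xp yp iy]] /indexE[q [qs xq zq iz]]|x y].
  have Epq := uniq_flatten_inj us ps qs xp xq; subst q.
  by apply: (index_inj x yp zq); rewrite /= iy iz.
move=> /indexE[p [ps xp yp iy]]; apply/negP=> /indexE[q [qs yq xq ix]].
have Epq := uniq_flatten_inj us ps qs xp xq; subst q.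
by move: (ltnn (index x p)); rewrite {2}ix iy ltnS leqnSn.
Qed.

(** The lists are built by induction on a vertex set closed under out-arcs: remove a source [v] of
    the set, decompose the rest, and put [v] in front of the path of its out-neighbor, or alone if
    it has none. *)
Lemma acyclic_directed_paths (H : digraph) :
  (forall x y z : H, arc x y -> arc x z -> y = z) ->
  (forall x y z : H, arc x z -> arc y z -> x = y) ->
  (forall x y : H, arc x y -> ~~ connect arc y x) ->
  directed_paths H.
Proof.
move=> arc_fun arc_inj acyc; pose h (x : H) := #|connect arc x|.
(* Everything reachable from [y] is reachable from [x], while acyclicity keeps [x] itself
   unreachable from [y]. *)
have h_lt (x y : H) : arc x y -> h y < h x.
  move=> xy; apply/proper_card/properP; split; last first.
    by exists x; [exact: connect0 | exact: acyc].
  by apply/subsetP=> z; apply: connect_trans; apply: connect1.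
suff pathsA (A : {set H}) : (forall x y : H, x \in A -> arc x y -> y \in A) ->
    exists s : seq (seq H),
      [/\ [::] \notin s, uniq (flatten s), flatten s =i A &
          forall x y : H,
            x \in A -> arc x y <-> exists2 p, p \in s & infix [:: x; y] p].
  have [//|s [s0 us sA sarc]] := pathsA setT.
  exists s; split=> // [x|x y]; first by rewrite sA inE.
  by apply: sarc; rewrite inE.
have [n] := ubnP #|A|; elim: n A => // n IHn A ltAn closA.
have [->|[v0 v0A]] := set_0Vmem A.
  by exists [::]; split=> // x; rewrite ?inE // => y; rewrite inE.
(* Since [h] drops along arcs, a maximizer of [h] receives no arc from [A]; hence [A :\ v] is still
   closed. *)
have [v /= vA vmax] := @arg_maxnP _ v0 (mem A) h v0A.
have closAv (x y : H) : x \in A :\ v -> arc x y -> y \in A :\ v.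
  rewrite !inE => /andP[_ xA] xy; rewrite (closA x) // andbT.
  by apply: contraTneq (h_lt _ _ xy) => ->; rewrite -leqNgt; apply: vmax.
have ltAv : #|A :\ v| < n by move: ltAn; rewrite (cardsD1 v) vA.
have [s [s0 us sA sarc]] := IHn _ ltAv closAv.
have vs : v \notin flatten s by rewrite sA !inE eqxx.
have [w vw|nov] := pickP (fun w => arc v w); last first.
  exists ([:: v] :: s); split=> [||x|x y xA] /=; rewrite ?vs //.
  - by rewrite inE sA !inE; case: eqP => // ->; rewrite vA.
  have [->|xv] := eqVneq x v.
    rewrite nov; split=> [//|[p]]; rewrite inE => /predU1P[->|ps xyp].
      by rewrite infixs1 /= eqseq_cons andbF.
    case/negP: vs; apply/flattenP; exists p => //.
    by have [] := index_infix2 (uniq_flatten_mem us ps) xyp.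
  have xAv : x \in A :\ v by rewrite !inE xv.
  split=> [/(sarc _ _ xAv)[p ps xyp]|[p pvs xyp]].
    by exists p => //; rewrite inE ps orbT.
  apply/(sarc _ _ xAv); exists p => //.
  move: pvs xyp; rewrite inE => /predU1P[->|//].
  by rewrite infixs1 /= eqseq_cons andbF.
have wA : w \in A :\ v.
  rewrite !inE (closA v) // andbT.
  by apply: contraTneq (h_lt _ _ vw) => ->; rewrite ltnn.
have /flattenP[p ps wp] : w \in flatten s by rewrite sA.
(* A predecessor [u] of [w] on its path would be a second in-neighbor besides [v], so [w] heads its
   path and [v] can be prepended. *)
have [q def_p] : exists q, p = w :: q.
  case/splitPr: wp ps => p1 p2; case: (lastP p1) => [|p3 u] ps.
    by exists p2.
  have uwp : infix [:: u; w] (rcons p3 u ++ w :: p2).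
    by rewrite cat_rcons; apply/infixP; exists p3, p2.
  have uA : u \in A :\ v.
    rewrite -sA; apply/flattenP; exists (rcons p3 u ++ w :: p2) => //.
    by rewrite mem_cat mem_rcons inE eqxx.
  have uw : arc u w by apply/(sarc _ _ uA); exists (rcons p3 u ++ w :: p2).
  by move: uA; rewrite (arc_inj _ _ _ uw vw) !inE eqxx.
subst p; have perm_s := perm_to_rem ps; set r := rem _ s in perm_s.
have fs : perm_eq (flatten s) (w :: q ++ flatten r) := perm_flatten perm_s.
have memr t : (t \in s) = (t == w :: q) || (t \in r).
  by rewrite (perm_mem perm_s) inE.
exists ((v :: w :: q) :: r); split=> [||x|x y xA] /=.
- by move: s0; rewrite memr !inE.
- by rewrite -[X in _ && X]/(uniq (w :: q ++ flatten r)) -(perm_uniq fs) us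
     -(perm_mem fs) vs.
- rewrite inE -[x \in _ :: _]/(x \in w :: q ++ flatten r) -(perm_mem fs) sA.
  by rewrite !inE; case: eqP => // ->; rewrite vA.
have [->|xv] := eqVneq x v.
  have nov t z : t \in s -> ~~ infix [:: v; z] t.
    move=> ts; apply: contra vs => vzt; apply/flattenP; exists t => //.
    by have [] := index_infix2 (uniq_flatten_mem us ts) vzt.
  split=> [vy|[t]].
    exists [:: v, w & q]; first by rewrite inE eqxx.
    by rewrite infix_consl /= (arc_fun _ _ _ vy vw) !eqxx prefix0s.
  rewrite inE => /predU1P[->|tr vyt].
    rewrite infix_consl (negPf (nov _ _ ps)) orbF /= => /and3P[_ /eqP-> _] //.
  by have := nov t y; rewrite memr tr orbT vyt => /(_ isT).
have xAv : x \in A :\ v by rewrite !inE xv.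
split=> [/(sarc _ _ xAv)[t]|[t tvs xyt]].
  rewrite memr => /predU1P[->|tr] xyt; last by exists t; rewrite // inE tr orbT.
  by exists [:: v, w & q]; rewrite ?inE ?eqxx // infix_consl xyt orbT.
apply/(sarc _ _ xAv); move: tvs xyt.
rewrite inE => /predU1P[->|tr xyt]; last by exists t; rewrite // memr tr orbT.
by rewrite infix_consl /= (negPf xv) /=; exists (w :: q).
Qed.

(** * Induced subgraphs as embeddings, and recognition of the forbidden patterns *)

Lemma has_inducedP (H G : sgraph) :
  has_induced H G <->
  exists2 g : H -> G, injective g & forall x y, edge (g x) (g y) = edge x y.
Proof.
split=> [[S [f [f' fK f'K] fE]]|[g g_inj gE]].
  exists (val \o f') => [|x y /=].
    exact: inj_comp val_inj (can_inj f'K).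
  by rewrite -[RHS]/(edge x y) -{2}(f'K x) -{2}(f'K y) fE.
have gS x : g x \in g @: setT by rewrite imset_f ?inE.
pose g' x : induced (g @: setT) := exist _ (g x) (gS x).
have g'_inj : injective g' by move=> x y /(congr1 val)/g_inj.
have card_le : #|induced (g @: setT)| <= #|H|.
  by rewrite card_sig (leq_trans (leq_imset_card _ _)) ?cardsT.
have [f fK f'K] := inj_card_bij g'_inj card_le.
exists (g @: setT), f => [|x y]; first by exists g'.
by rewrite -gE -[edge _ _]/(edge (g' (f x)) (g' (f y))) !f'K.
Qed.

Section Patterns.
Variable G : sgraph.

Lemma edge_neq (x y : G) : edge x y -> x != y.
Proof. by apply: contraTneq => ->; rewrite edge_irrefl. Qed.

Definition p4 (a b c d : G) :=
  [&& edge a b, edge b c, edge c d, ~~ edge a c, ~~ edge a d & ~~ edge b d].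

(** Symmetry leaves only the pairs [i < j], so for a concrete list of vertices an embedding is
    checked by finitely many cases. *)
Lemma has_induced_nth n (e : rel 'I_n) (es : symmetric e) (ei : irreflexive e)
    (x0 : G) (s : seq G) :
  uniq s -> size s = n ->
  (forall i j : 'I_n, i < j -> edge (nth x0 s i) (nth x0 s j) = e i j) ->
  has_induced (SGraph es ei) G.
Proof.
move=> us ss sE; apply/has_inducedP; exists (fun i : 'I_n => nth x0 s i).
  by move=> i j /eqP; rewrite nth_uniq ?ss // => /eqP/val_inj.
move=> i j; rewrite -[RHS]/(e i j); case: (ltngtP i j) => [/sE//|/sE Eji|].
  by rewrite edge_sym Eji es.
by move/val_inj->; rewrite edge_irrefl ei.
Qed.

Lemma ex_C4 (a b c d : G) : edge a b -> edge b c -> edge c d -> edge d a ->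
  ~~ edge a c -> ~~ edge b d -> a != c -> b != d ->
  has_induced (cycle_graph 4) G.
Proof.
move=> ab bc cd da ac bd nac nbd.
apply: (@has_induced_nth _ _ _ _ a [:: a; b; c; d]) => //.
  rewrite /= !inE !negb_or nac nbd (edge_neq ab) (edge_neq bc) (edge_neq cd).
  by rewrite eq_sym (edge_neq da).
case=> [[|[|[|[|i]]]] lti] [[|[|[|[|j]]]] ltj] //= _; rewrite /cycle_edge /=.
all: by rewrite ?ab ?bc ?cd ?(negPf ac) ?(negPf bd) // edge_sym da.
Qed.

Lemma ex_2K2 (a b c d : G) : edge a b -> edge c d ->
  ~~ edge a c -> ~~ edge a d -> ~~ edge b c -> ~~ edge b d ->
  has_induced (compl (cycle_graph 4)) G.
Proof.
move=> ab cd ac ad bc bd.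
have nac : a != c by apply: contraNneq ad => ->.
have nad : a != d by apply: contraNneq ac => ->; rewrite edge_sym.
have nbc : b != c by apply: contraNneq bd => ->.
have nbd : b != d by apply: contraNneq bc => ->; rewrite edge_sym.
(* In this order [ab] and [cd] are the diagonals of the 4-cycle, hence the edges of its
   complement. *)
apply: (@has_induced_nth _ _ _ _ a [:: a; c; b; d]) => //.
  rewrite /= !inE !negb_or nac nad (edge_neq ab) (edge_neq cd) nbd.
  by rewrite eq_sym nbc.
case=> [[|[|[|[|i]]]] lti] [[|[|[|[|j]]]] ltj] //= _.
all: rewrite /compl_edge /= /cycle_edge /=.
all: rewrite ?ab ?cd ?(negPf ac) ?(negPf ad) ?(negPf bd) //.
all: by rewrite edge_sym (negPf bc).
Qed.

Lemma ex_C5 (a b c d e : G) : edge a b -> edge b c -> edge c d -> edge d e ->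
  edge e a -> ~~ edge a c -> ~~ edge a d -> ~~ edge b d -> ~~ edge b e ->
  ~~ edge c e -> has_induced (cycle_graph 5) G.
Proof.
move=> ab bc cd de ea ac ad bd be ce.
have nac : a != c by apply: contraNneq ad => ->.
have nad : a != d by apply: contraNneq ac => ->; rewrite edge_sym.
have nbd : b != d by apply: contraNneq be => ->.
have nbe : b != e by apply: contraNneq bd => ->; rewrite edge_sym.
have nce : c != e by apply: contraNneq ac => ->; rewrite edge_sym.
have nae : a != e by rewrite eq_sym edge_neq.
apply: (@has_induced_nth _ _ _ _ a [:: a; b; c; d; e]) => //.
  rewrite /= !inE !negb_or nac nad nae nbd nbe nce (edge_neq ab) (edge_neq bc).
  by rewrite (edge_neq cd) (edge_neq de).
case=> [[|[|[|[|[|i]]]]] lti] [[|[|[|[|[|j]]]]] ltj] //= _.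
all: rewrite /cycle_edge /=.
all: rewrite ?ab ?bc ?cd ?de ?(negPf ac) ?(negPf ad) ?(negPf bd) ?(negPf be) //.
all: by rewrite ?(negPf ce) // edge_sym ea.
Qed.

Lemma ex_chair (x y z t v : G) : edge x y -> edge y z -> edge z t -> edge z v ->
  ~~ edge x z -> ~~ edge x t -> ~~ edge x v -> ~~ edge y t -> ~~ edge y v ->
  ~~ edge t v -> t != v -> has_induced chair G.
Proof.
move=> xy yz zt zv xz xt xv yt yv tv ntv.
have nxz : x != z by apply: contraNneq xt => ->.
have nxt : x != t by apply: contraNneq xz => ->; rewrite edge_sym.
have nxv : x != v by apply: contraNneq xz => ->; rewrite edge_sym.
have nyt : y != t by apply: contraNneq xt => <-.
have nyv : y != v by apply: contraNneq xv => <-.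
apply: (@has_induced_nth _ _ _ _ x [:: x; y; z; t; v]) => //.
  rewrite /= !inE !negb_or nxz nxt nxv nyt nyv ntv (edge_neq xy) (edge_neq yz).
  by rewrite (edge_neq zt) (edge_neq zv).
case=> [[|[|[|[|[|i]]]]] lti] [[|[|[|[|[|j]]]]] ltj] //= _.
all: rewrite /chair_edge /= ?xy ?yz ?zt ?zv ?(negPf xz) ?(negPf xt) ?(negPf xv).
all: by rewrite ?(negPf yt) ?(negPf yv) ?(negPf tv).
Qed.

(** The labels are those of the underlying chair: its four edges are the non-adjacencies assumed
    here. *)
Lemma ex_cochair (x y z t v : G) :
  edge z x -> edge x t -> edge x v -> edge y t -> edge y v -> edge t v ->
  ~~ edge x y -> ~~ edge y z -> ~~ edge z t -> ~~ edge z v ->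
  has_induced cochair G.
Proof.
move=> zx xt xv yt yv tv xy yz zt zv.
have nxy : x != y by apply: contraNneq yz => <-; rewrite edge_sym.
have nyz : y != z by apply: contraNneq zt => <-.
have nzt : z != t by apply: contraNneq zv => ->.
have nzv : z != v by apply: contraNneq zt => ->; rewrite edge_sym.
have nxz : x != z by rewrite eq_sym edge_neq.
apply: (@has_induced_nth _ _ _ _ x [:: x; y; z; t; v]) => //.
  rewrite /= !inE !negb_or nxy nyz nzt nzv nxz (edge_neq xt) (edge_neq xv).
  by rewrite (edge_neq yt) (edge_neq yv) (edge_neq tv).
case=> [[|[|[|[|[|i]]]]] lti] [[|[|[|[|[|j]]]]] ltj] //= _.
all: rewrite /compl_edge /= /chair_edge /=.
all: rewrite ?xt ?xv ?yt ?yv ?tv ?(negPf xy) ?(negPf yz) ?(negPf zt) //.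
all: by rewrite ?(negPf zv) // edge_sym zx.
Qed.

End Patterns.

(** * Ends of induced 4-vertex paths in a comb *)

Section P4Ends.
Variable M : sgraph.
Hypothesis combM : comb M.

Lemma p4_rev (a b c d : M) : p4 a b c d -> p4 d c b a.
Proof.
case/and5P=> ab bc cd ac /andP[ad bd].
rewrite /p4 !(edge_sym d) !(edge_sym c b) (edge_sym b a) (edge_sym c a).
by rewrite ab bc cd ac ad bd.
Qed.

(** If [w] misses [b], its adjacencies to [c] and [d] yield the 4-cycle [abcw], the 5-cycle [abcdw],
    or the co-C4 formed by [aw] and [cd]. If it meets [b] but not [c], they yield the 4-cycle [wbcd]
    or the same co-C4. *)
Lemma p4_end_nbr (a b c d w : M) :
  p4 a b c d -> edge a w -> w != b -> edge w b && edge w c.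
Proof.
case: combM => nC4 n2K2 nC5 _ _ /and5P[ab bc cd ac /andP[ad bd]] aw wb.
have nac : a != c by apply: contraNneq ad => ->.
have ncw : c != w by apply: contraNneq ac => ->.
have wbE : edge w b.
  apply: contraT => wbN; have [wc|wc] := boolP (edge w c).
    case: nC4; apply: (ex_C4 ab bc (d := w)); rewrite // 1?edge_sym //.
    by rewrite eq_sym.
  have [wd|wd] := boolP (edge w d).
    case: nC5; apply: (ex_C5 ab bc cd (e := w)) => //; try by rewrite edge_sym.
  by case: n2K2; apply: (ex_2K2 aw cd).
rewrite wbE; apply: contraT => wc; have [wd|wd] := boolP (edge w d).
  have nbd : b != d by apply: contraNneq ad => <-.
  by case: nC4; apply: (ex_C4 wbE bc cd); rewrite // 1?edge_sym // eq_sym.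
by case: n2K2; apply: (ex_2K2 aw cd).
Qed.

(** As a neighbor of the end [b] of the second path, [a] is [b'] or sees [c']; in both cases [a]
    sees [c']. Then [c'], as a neighbor of the end [a] of the first path, must see [b], which the
    second path forbids. *)
Lemma p4_end_not_mid (a b c d b' c' d' : M) : p4 a b c d -> ~~ p4 b b' c' d'.
Proof.
move=> P; apply/negP=> P'; have /and5P[ab _ _ _ _] := P.
have /and5P[_ bc' cd' ac' /andP[ad' _]] := P'.
have aEc' : edge a c'.
  have [->//|ab'] := eqVneq a b'.
  by have /andP[] := p4_end_nbr P' (etrans (edge_sym _ _) ab) ab'.
have nc'b : c' != b by apply: contraNneq ad' => <-.
by have := p4_end_nbr P aEc' nc'b; rewrite edge_sym (negPf ac').
Qed.

(** If [a] and [a'] were adjacent, applying [p4_end_nbr] to both paths would make [a'] see [c], [a]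
    see [c'], and then [c] see [c'], so that [a a' c c'] is an induced 4-cycle. *)
Lemma p4_ends_stable (a b c d a' b' c' d' : M) :
  p4 a b c d -> p4 a' b' c' d' -> ~~ edge a a'.
Proof.
move=> P P'; apply/negP=> aa'; have a'a : edge a' a by rewrite edge_sym.
have na'b : a' != b.
  by apply: contraTneq P' => ->; apply: p4_end_not_mid P.
have nab' : a != b'.
  by apply: contraTneq P => ->; apply: p4_end_not_mid P'.
have /andP[_ a'c] := p4_end_nbr P aa' na'b.
have /andP[ab' ac'] := p4_end_nbr P' a'a nab'.
have /and5P[_ _ cd ac /andP[ad _]] := P.
have /and5P[_ _ cd' ac'' /andP[ad' _]] := P'.
have ncb' : c != b' by apply: contraNneq ac => ->.
have /andP[_ cc'] := p4_end_nbr P' a'c ncb'.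
have nac : a != c by apply: contraNneq ad => ->.
have nac' : a' != c' by apply: contraNneq ad' => ->.
case: combM => nC4 _ _ _ _; case: nC4.
by apply: (ex_C4 aa' a'c cc'); rewrite // edge_sym.
Qed.
End P4Ends.

(** * Losing along induced 4-vertex paths, for an abstract orientation [A] that is later [arc] or
    its reverse *)

Section Beats.
Variables (M : sgraph) (A : rel M).
Hypothesis combM : comb M.
Hypothesis A_asym : forall x y, A x y -> ~~ A y x.
Hypothesis A_total : forall x y, x != y -> ~~ edge x y -> A x y || A y x.
Hypothesis A_edge : forall x y, A x y -> ~~ edge x y.

Lemma A_neq x y : A x y -> x != y.
Proof.
by apply: contraTneq => ->; apply/negP=> Ayy; case/negP: (A_asym Ayy).
Qed.

Definition far (x y : M) := ~~ A x y && [forall u, ~~ (A x u && A u y)].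

(** This is [ab] losing to [cd] with the labelling fixed by the path, so that [a] and [d] are the
    outer ends. *)
Definition beats (a b c d : M) :=
  [&& p4 a b c d, A a c, A b d, far a d & far b c].

(** The nonadjacent vertices [a] and [d] are joined by some arc, and [far a d] excludes the one
    leaving [a]. *)
Lemma beats_back (a b c d : M) : beats a b c d -> A d a.
Proof.
case/and5P=> P ac _ /andP[ad _] _; have /and5P[_ _ cd _ /andP[nad _]] := P.
have da : a != d.
  by apply: contraTneq ac => ->; apply/negP=> /A_edge; rewrite edge_sym cd.
by have := A_total da nad; rewrite (negPf ad).
Qed.

Lemma beats_functional (a b c d c' d' : M) :
  beats a b c d -> beats a b c' d' -> c = c' /\ d = d'.
Proof.
move=> B B'; case: (combM) => nC4 n2K2 _ nch ncoch.
have /and5P[P Aac Abd /andP[_ /forallP fad] /andP[_ /forallP fbc]] := B.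
have /and5P[P' Aac' Abd' /andP[_ /forallP fad'] /andP[_ /forallP fbc']] := B'.
have /and5P[ab bc cd ac /andP[ad bd]] := P.
have /and5P[_ bc' cd' ac' /andP[ad' bd']] := P'.
have dc : edge d c by rewrite edge_sym.
have d'c' : edge d' c' by rewrite edge_sym.
have c'b : edge c' b by rewrite edge_sym.
have nbd : b != d by apply: contraNneq ad => <-.
have nbd' : b != d' by apply: contraNneq ad' => <-.
have [Ec|ncc'] := eqVneq c c'.
  subst c'; split=> //; apply/eqP; apply: contraT => ndd'.
  (* With [c] shared, [d] and [d'] are ends of induced paths, hence nonadjacent, and [a b c d d'] is
     a chair. *)
  case: nch; apply: (ex_chair ab bc cd) ndd' => //.
  apply/negP=> dd'.
  by have := p4_ends_stable combM (p4_rev P) (p4_rev P'); rewrite dd'.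
have dd' : ~~ edge d d' := p4_ends_stable combM (p4_rev P) (p4_rev P').
(* Otherwise [bcdc'] or [bcd'c'] is an induced 4-cycle, or [cd] and [c'd'] form a co-C4. *)
have cc' : edge c c'.
  apply: contraT => cc'; have [dc'|dc'] := boolP (edge d c').
    by case: nC4; apply: (ex_C4 bc cd dc').
  have [cd'c|cd'c] := boolP (edge c d').
    by case: nC4; apply: (ex_C4 bc cd'c d'c').
  by case: n2K2; apply: (ex_2K2 cd cd').
have [dc'|dc'] := boolP (edge d c').
  by case: ncoch; apply: (ex_cochair ab bc bc' dc dc' cc'); rewrite // edge_sym.
have ndc' : d != c' by apply: contraNneq bd => ->.
(* The two orientations create the paths [b -> d -> c'] and [a -> c' -> d], against [far b c'] and
   [far a d]. *)
have /orP[Adc'|Ac'd] := A_total ndc' dc'.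
  by have := fbc' d; rewrite Abd Adc'.
by have := fad c'; rewrite Aac' Ac'd.
Qed.

(** Both [d] and [a0] are ends of induced paths, so an arc joins them; [a0 -> d] would complete
    [a -> a0 -> d], against [far a d]. *)
Lemma beats_step (a0 b0 c0 d0 a b c d : M) :
  p4 a0 b0 c0 d0 -> A a a0 -> beats a b c d -> A d a0.
Proof.
move=> P0 Aaa0 B; have Ada := beats_back B.
have /and5P[P _ _ /andP[_ /forallP fad] _] := B.
have nda0 : d != a0 by apply: contraTneq Ada => ->; apply: A_asym.
have /orP[//|Aa0d] := A_total nda0 (p4_ends_stable combM (p4_rev P) P0).
by have := fad a0; rewrite Aaa0 Aa0d.
Qed.

(** Of the cross pairs [y1 x2] and [x1 y2], both being edges gives an induced 4-cycle and neither
    gives a co-C4; exactly one gives an induced path, whose direction decides the alternative. *)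
Lemma split_beats (x1 y1 x2 y2 : M) :
  edge x1 y1 -> edge x2 y2 -> A x1 x2 -> A y1 y2 -> far x1 y2 -> far y1 x2 ->
  beats x1 y1 x2 y2 \/ beats y1 x1 y2 x2.
Proof.
move=> e1 e2 Ax Ay f1 f2; case: (combM) => nC4 n2K2 _ _ _.
have y1x1 : edge y1 x1 by rewrite edge_sym.
have y2x2 : edge y2 x2 by rewrite edge_sym.
have [nx ny] := (A_edge Ax, A_edge Ay).
have [dx dy] := (A_neq Ax, A_neq Ay).
have [yx|yx] := boolP (edge y1 x2); have [xy|xy] := boolP (edge x1 y2).
- by case: nC4; apply: (ex_C4 e1 yx e2); rewrite // edge_sym.
- by left; apply/and5P; split=> //; rewrite /p4 e1 yx e2 nx xy ny.
- by right; apply/and5P; split=> //; rewrite /p4 y1x1 xy y2x2 ny yx nx.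
- by case: n2K2; apply: (ex_2K2 e1 e2).
Qed.
End Beats.

(** * The graph of missing edges, and the dependency digraph when it is a comb *)

Lemma set2_eq (T : finType) (a b c d : T) :
  [set a; b] = [set c; d] -> a = c /\ b = d \/ a = d /\ b = c.
Proof.
move=> E; have := set21 a b; have := set22 a b.
rewrite E !inE => /orP[]/eqP Eb /orP[]/eqP Ea; [left|by right|by left|left].
  by have := set22 c d; rewrite -E !inE Ea Eb orbb => /eqP->.
by have := set21 c d; rewrite -E !inE Ea Eb orbb => /eqP->.
Qed.

Section MissingGraph.
Variable D : oriented_graph.

Lemma missing_sym : symmetric (@missing D).
Proof. by move=> x y; rewrite /missing eq_sym [~~ arc x y && _]andbC. Qed.

Lemma missing_irrefl : irreflexive (@missing D).
Proof. by move=> x; rewrite /missing eqxx. Qed.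

Definition missing_graph := SGraph missing_sym missing_irrefl.

Lemma missing_edge_set2 (x y : D) : missing_edge [set x; y] = missing x y.
Proof.
apply/existsP/idP=> [[u /existsP[v /andP[uv /eqP/set2_eq]]]|xy].
  by case=> [[-> ->//]|[-> ->]]; rewrite missing_sym.
by exists x; apply/existsP; exists y; rewrite xy eqxx.
Qed.

Lemma notin_out2 (x y : D) :
  (y \notin out_nbr x :|: out_nbr2 x) = far (M := missing_graph) arc x y.
Proof.
rewrite /far !inE negb_or negb_and negbK; case: (arc x y) => //=.
apply/negP/forallP=> [noU u|noU /bigcupP[u]]; last first.
  by rewrite !inE => xu uy; have := noU u; rewrite xu uy.
by apply/negP=> /andP[xu uy]; apply/noU/bigcupP; exists u; rewrite inE.
Qed.

(** Vertices of [D] outside the image of [G] are isolated in [missing_graph], so a pattern without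
    isolated vertices lies inside that image. *)
Lemma has_induced_missing (G H : sgraph) :
  is_missing D G -> (forall x : H, exists y : H, edge x y) ->
  has_induced H missing_graph -> has_induced H G.
Proof.
case=> f f_inj fE Hiso /has_inducedP[g g_inj gE].
have gf x : g x \in codom f.
  have [y xy] := Hiso x; have /fE[u [v [fu _ _]]] : missing (g x) (g y).
    by rewrite -[missing _ _]/(@edge missing_graph _ _) gE.
  by rewrite -fu codom_f.
have fgK x : f (iinv (gf x)) = g x by rewrite f_iinv.
apply/has_inducedP; exists (fun x => iinv (gf x)) => x y.
  by move/(congr1 f); rewrite !fgK => /g_inj.
rewrite -gE /=; apply/idP/idP=> [xy|/fE[u [v [fu fv]]]].
  by apply/fE; exists (iinv (gf x)), (iinv (gf y)).
rewrite -fgK in fu; rewrite -fgK in fv.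
by rewrite (f_inj _ _ fu) (f_inj _ _ fv).
Qed.

Lemma comb_missing (G : sgraph) :
  is_missing D G -> comb G -> comb missing_graph.
Proof.
move=> DG [n1 n2 n3 n4 n5].
pose o n (i : nat) (lti : i < n) := Ordinal lti.
split; [apply: contra_not n1 | apply: contra_not n2 | apply: contra_not n3
  | apply: contra_not n4 | apply: contra_not n5];
  apply: (has_induced_missing DG).
(* For each of the five patterns, a neighbor of every vertex is listed. *)
- case=> [[|[|[|[|i]]]] lti] //; [exists (o 4 1 isT) | exists (o 4 2 isT)
    | exists (o 4 3 isT) | exists (o 4 0 isT)]; by [].
- case=> [[|[|[|[|i]]]] lti] //; [exists (o 4 2 isT) | exists (o 4 3 isT)
    | exists (o 4 0 isT) | exists (o 4 1 isT)]; by [].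
- case=> [[|[|[|[|[|i]]]]] lti] //; [exists (o 5 1 isT) | exists (o 5 2 isT)
    | exists (o 5 3 isT) | exists (o 5 4 isT) | exists (o 5 0 isT)]; by [].
- case=> [[|[|[|[|[|i]]]]] lti] //; [exists (o 5 1 isT) | exists (o 5 2 isT)
    | exists (o 5 3 isT) | exists (o 5 2 isT) | exists (o 5 2 isT)]; by [].
- case=> [[|[|[|[|[|i]]]]] lti] //; [exists (o 5 2 isT) | exists (o 5 3 isT)
    | exists (o 5 0 isT) | exists (o 5 1 isT) | exists (o 5 1 isT)]; by [].
Qed.

Local Notation A := (@arc D : rel missing_graph).

Lemma arc_total (x y : missing_graph) : x != y -> ~~ edge x y -> A x y || A y x.
Proof. by rewrite /= /missing => -> /=; rewrite -negb_or negbK. Qed.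

Lemma arc_nonedge (x y : missing_graph) : A x y -> ~~ edge x y.
Proof. by rewrite /= /missing => ->; rewrite andbF. Qed.

Hypothesis combD : comb missing_graph.

Lemma loses_beats (e e' : dependency D) : arc e e' ->
  exists a b c d : missing_graph,
    [/\ val e = [set a; b], val e' = [set c; d] & beats A a b c d].
Proof.
case/existsP=> x1 /existsP[y1 /existsP[x2 /existsP[y2]]].
rewrite !notin_out2 => /and5P[/eqP Ee /eqP Ee' Ax f1 /andP[Ay f2]].
have xy1 : missing x1 y1 by rewrite -missing_edge_set2 -Ee (valP e).
have xy2 : missing x2 y2 by rewrite -missing_edge_set2 -Ee' (valP e').
have asym := @oarc_nodigon D.
have [B|B] := split_beats combD asym arc_nonedge xy1 xy2 Ax Ay f1 f2.
  by exists x1, y1, x2, y2.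
exists y1, x1, y2, x2.
by rewrite Ee Ee' ![[set x1; _]]setUC ![[set x2; _]]setUC.
Qed.

Lemma beats_rev (a b c d : missing_graph) :
  beats A a b c d -> beats (fun x y => A y x) d c b a.
Proof.
have far_rev x y : far A x y -> far (fun x y => A y x) y x.
  case/andP=> xy /forallP noxy; rewrite /far xy.
  by apply/forallP=> u; rewrite andbC.
by case/and5P=> /p4_rev P ac bd /far_rev fad /far_rev fbc; apply/and5P.
Qed.

Lemma beats_p4 (a b c d : missing_graph) : beats A a b c d -> p4 a b c d.
Proof. by case/and5P. Qed.

(** The exchanged labelling would make an end of one path an inner vertex of the other. Hence the
    outer end of an end edge depends on the edge alone, which lets consecutive losses be matched. *)
Lemma p4_end_unique (a b c d a' b' c' d' : missing_graph) :
  p4 a b c d -> p4 a' b' c' d' -> [set a; b] = [set a'; b'] ->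
  a = a' /\ b = b'.
Proof.
move=> P P' /set2_eq[//|[Ea Eb]]; subst a b.
by have := p4_end_not_mid combD b' c' d' P; rewrite P'.
Qed.

Lemma dependency_functional (e e1 e2 : dependency D) :
  arc e e1 -> arc e e2 -> e1 = e2.
Proof.
move=> /loses_beats[a [b [c [d [Ee E1 B]]]]].
move=> /loses_beats[a' [b' [c' [d' [Ee' E2 B']]]]].
have Eab : [set a; b] = [set a'; b'] by rewrite -Ee -Ee'.
have [Ea Eb] := p4_end_unique (beats_p4 B) (beats_p4 B') Eab; subst a' b'.
have [Ec Ed] := beats_functional combD arc_total B B'.
by apply: val_inj; rewrite E1 E2 Ec Ed.
Qed.

Lemma dependency_injective (e1 e2 e : dependency D) :
  arc e1 e -> arc e2 e -> e1 = e2.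
Proof.
move=> /loses_beats[a [b [c [d [E1 Ee /beats_rev B]]]]].
move=> /loses_beats[a' [b' [c' [d' [E2 Ee' /beats_rev B']]]]].
have Ecd : [set d; c] = [set d'; c'] by rewrite setUC -Ee Ee' setUC.
have [P P'] : p4 d c b a /\ p4 d' c' b' a' by case/and5P: B; case/and5P: B'.
have [Ed Ec] := p4_end_unique P P' Ecd; subst c' d'.
have rev_total (x y : missing_graph) :
    x != y -> ~~ edge x y -> A y x || A x y.
  by move=> xy nxy; rewrite orbC; apply: arc_total.
have [Eb Ea] := beats_functional combD rev_total B B'.
by apply: val_inj; rewrite E1 E2 Ea Eb.
Qed.

Lemma dependency_acyclic (e e1 : dependency D) :
  arc e e1 -> ~~ connect arc e1 e.
Proof.
have asym := @oarc_nodigon D.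
move=> /loses_beats[a [b [c [d [Ee E1 B]]]]].
apply/connectP=> -[p path_p last_p]; have P := beats_p4 B.
(* Invariant of the walk: the outer end [v] of the current edge has an arc to the fixed outer end
   [a] of [e]. *)
have chain q (f : dependency D) (u v u' v' : missing_graph) :
    path arc f q -> val f = [set v; u] -> p4 v u u' v' -> A v a ->
    exists x y x' y' : missing_graph,
      [/\ val (last f q) = [set y; x], p4 y x x' y' & A y a].
  elim: q f u v u' v' => [|g q IHq] f u v u' v' /=.
    by exists u, v, u', v'.
  case/andP=> /loses_beats[s [t [x [y [Ef Eg B']]]]] gq Ef' Pv Ava.
  have Est : [set s; t] = [set v; u] by rewrite -Ef.
  have [Es Et] := p4_end_unique (beats_p4 B') Pv Est; subst s t.
  apply: IHq gq _ (p4_rev (beats_p4 B')) _; first by rewrite setUC.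
  exact: (beats_step combD asym arc_total arc_nonedge P Ava B').
have E1' : val e1 = [set d; c] by rewrite setUC.
have [x [y [x' [y' [El P' Aya]]]]] :=
  chain _ _ _ _ _ _ path_p E1' (p4_rev P) (beats_back arc_total arc_nonedge B).
(* Back at [e], the outer end is [a] itself, and the invariant becomes a loop at [a]. *)
rewrite -last_p Ee in El; have [Ea _] := p4_end_unique P P' El.
by rewrite -Ea oarc_irrefl in Aya.
Qed.

End MissingGraph.

(** * Extending an oriented pattern to an oriented graph missing [G] *)

Section Extension.
Variables (H G : sgraph) (r : rel H) (g : H -> G).
Hypothesis r_tournament : forall i j : H, i != j -> r j i = ~~ r i j.
Hypothesis g_inj : injective g.
Hypothesis g_edge : forall i j : H, edge (g i) (g j) = edge i j.

(* Outside the copy of H, vertices are ordered by rank and dominate the copy,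
   so that directed paths leaving the copy do not exist. *)
Definition ext_order : rel G := fun x y =>
  match [pick i | g i == x], [pick j | g j == y] with
  | Some i, Some j => r i j
  | Some _, None => false
  | None, Some _ => true
  | None, None => enum_rank x < enum_rank y
  end.

Definition ext_arc : rel G :=
  fun x y => [&& x != y, ~~ edge x y & ext_order x y].

Lemma ext_order_tournament x y : x != y -> ext_order y x = ~~ ext_order x y.
Proof.
rewrite /ext_order; case: pickP => [i /eqP<-|_]; case: pickP => [j /eqP<-|_] //.
  by rewrite (inj_eq g_inj) => /r_tournament.
rewrite -leqNgt ltn_neqAle (inj_eq val_inj) (inj_eq enum_rank_inj) => xy.
by rewrite eq_sym xy.
Qed.

Lemma ext_arc_irrefl : irreflexive (@arc (Digraph ext_arc)).
Proof. by move=> x; rewrite /= /ext_arc eqxx. Qed.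

Lemma ext_arc_nodigon (x y : Digraph ext_arc) : arc x y -> ~~ arc y x.
Proof.
case/and3P=> xy _ oxy; apply/negP=> /and3P[_ _].
by rewrite (ext_order_tournament xy) oxy.
Qed.

Definition extension := OrientedGraph ext_arc_irrefl ext_arc_nodigon.

Lemma missing_extension (x y : G) : @missing extension x y = edge x y.
Proof.
rewrite /missing /= /ext_arc [y == x]eq_sym [edge y x]edge_sym.
have [<-|xy] := eqVneq x y; first by rewrite edge_irrefl.
by rewrite (ext_order_tournament xy); case: (edge x y); case: ext_order.
Qed.

Lemma is_missing_extension : is_missing extension G.
Proof.
exists id => // x y; rewrite missing_extension.
by split=> [xy|[u [v [<- <-]]]] //; exists x, y.
Qed.

Definition pattern_arc : rel H := fun i j => [&& i != j, ~~ edge i j & r i j].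

Lemma ext_arc_pattern (i j : H) : ext_arc (g i) (g j) = pattern_arc i j.
Proof.
rewrite /ext_arc /pattern_arc g_edge (inj_eq g_inj) /ext_order.
case: pickP => [k /eqP/g_inj->|/(_ i)/eqP//].
by case: pickP => [l /eqP/g_inj->|/(_ j)/eqP].
Qed.

Lemma ext_arc_from_pattern (i : H) (y : G) :
  ext_arc (g i) y -> exists j : H, y = g j.
Proof.
case/and3P=> _ _; rewrite /ext_order.
case: pickP => [k _|/(_ i)/eqP//]; case: pickP => // l /eqP <- _.
by exists l.
Qed.

Definition pattern_far (i j : H) :=
  ~~ pattern_arc i j /\ forall k, ~~ (pattern_arc i k && pattern_arc k j).

(** Arcs leaving a vertex of the copy stay in the copy, so the middle vertex of a directed path of
    length 2 comes from the pattern. *)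
Lemma far_extension (i j : H) :
  pattern_far i j ->
  g j \notin @out_nbr extension (g i) :|: @out_nbr2 extension (g i).
Proof.
case=> ij noij; rewrite notin_out2 /far /= ext_arc_pattern ij.
apply/forallP=> u; apply/negP=> /andP[iu].
have [k Eu] := ext_arc_from_pattern iu; move: iu; rewrite Eu !ext_arc_pattern.
by move=> ik kj; have := noij k; rewrite ik kj.
Qed.

Lemma missing_edge_extension (i j : H) :
  edge i j -> @missing_edge extension [set g i; g j].
Proof. by move=> ij; rewrite missing_edge_set2 missing_extension g_edge. Qed.

Definition ext_missing (i j : H) (ij : edge i j) : dependency extension :=
  exist (fun e => @missing_edge extension e) _ (missing_edge_extension ij).

Lemma loses_extension (i j k l : H) :
  pattern_arc i k -> pattern_arc j l -> pattern_far i l -> pattern_far j k ->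
  @loses extension [set g i; g j] [set g k; g l].
Proof.
move=> ik jl il jk; apply/existsP; exists (g i); apply/existsP; exists (g j).
apply/existsP; exists (g k); apply/existsP; exists (g l).
by rewrite !eqxx !far_extension //= !ext_arc_pattern ik jl.
Qed.

(** In [extension] the missing edges [ij] and [kl] lose to each other, the second time with [i] and
    [j] exchanged. *)
Lemma not_forcing_of_digon (i j k l : H) :
  edge i j -> edge k l ->
  pattern_arc i k -> pattern_arc j l -> pattern_far i l -> pattern_far j k ->
  pattern_arc k j -> pattern_arc l i -> pattern_far k i -> pattern_far l j ->
  ~ forcing directed_paths G.
Proof.
move=> ij kl ik jl il jk kj li ki lj.
case/(_ _ is_missing_extension)/directed_paths_arc => _.
move/(_ (ext_missing ij) (ext_missing kl)).
rewrite /= loses_extension // [[set g i; _]]setUC.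
by rewrite loses_extension // => /(_ isT).
Qed.

Lemma not_forcing_of_fork (i j k l k' l' : H) :
  edge i j -> edge k l -> edge k' l' -> [set k; l] != [set k'; l'] ->
  pattern_arc i k -> pattern_arc j l ->
  pattern_far i l -> pattern_far j k ->
  pattern_arc i k' -> pattern_arc j l' ->
  pattern_far i l' -> pattern_far j k' ->
  ~ forcing directed_paths G.
Proof.
move=> ij kl kl' /eqP neq ik jl il jk ik' jl' il' jk'.
case/(_ _ is_missing_extension)/directed_paths_arc => + _.
move/(_ (ext_missing ij) (ext_missing kl) (ext_missing kl')).
rewrite /= !loses_extension // => /(_ isT isT)/(congr1 val) /= E.
by apply: neq; apply: (imset_inj g_inj); rewrite !imsetU1 !imset_set1.
Qed.
End Extension.

(** * Counterexamples from the co-C4, the chair and the co-chair *)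

(* Chosen so that 0 -> 1 -> 2 -> 3 -> 0 in the co-C4; 01 loses to 23 and 24 in
   the chair; and 20 loses to 31 and 41 in the co-chair. *)
Definition pattern_order n : rel 'I_n :=
  fun i j => if i == 0 :> nat then 0 < j < 3
    else if j == 0 :> nat then 3 <= i else i < j.

Lemma pattern_order_tournament n (i j : 'I_n) :
  i != j -> pattern_order j i = ~~ pattern_order i j.
Proof.
rewrite /pattern_order -(inj_eq val_inj) /=.
case: i j => [[|i] lti] [[|j] ltj] //= nij.
- by rewrite -leqNgt.
- by rewrite -ltnNge.
- by rewrite -leqNgt ltn_neqAle eq_sym nij.
Qed.

Ltac pattern_cases := repeat split; repeat case=> [[|[|[|[|[|?]]]]] ?] //.

Lemma forcing_2K2_free (G : sgraph) :
  forcing directed_paths G -> ~ has_induced (compl (cycle_graph 4)) G.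
Proof.
move=> forceG /has_inducedP[g g_inj gE]; pose o i (lti : i < 4) := Ordinal lti.
(* The missing edges are the diagonals 02 and 13 of the directed 4-cycle, so each vertex is at
   distance 3 from its predecessor. *)
refine (@not_forcing_of_digon (compl (cycle_graph 4)) G (@pattern_order 4) g
  (@pattern_order_tournament 4) g_inj gE
  (o 0 isT) (o 2 isT) (o 1 isT) (o 3 isT) _ _ _ _ _ _ _ _ _ _ forceG);
  pattern_cases.
Qed.

Lemma forcing_chair_free (G : sgraph) :
  forcing directed_paths G -> ~ has_induced chair G.
Proof.
move=> forceG /has_inducedP[g g_inj gE]; pose o i (lti : i < 5) := Ordinal lti.
refine (@not_forcing_of_fork chair G (@pattern_order 5) g
  (@pattern_order_tournament 5) g_inj gE
  (o 0 isT) (o 1 isT) (o 2 isT) (o 3 isT)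
  (o 2 isT) (o 4 isT) _ _ _ _ _ _ _ _ _ _ _ _ forceG); pattern_cases.
by apply/eqP=> /set2_eq[[]|[]].
Qed.

Lemma forcing_cochair_free (G : sgraph) :
  forcing directed_paths G -> ~ has_induced cochair G.
Proof.
move=> forceG /has_inducedP[g g_inj gE]; pose o i (lti : i < 5) := Ordinal lti.
refine (@not_forcing_of_fork cochair G (@pattern_order 5) g
  (@pattern_order_tournament 5) g_inj gE
  (o 2 isT) (o 0 isT) (o 3 isT) (o 1 isT)
  (o 4 isT) (o 1 isT) _ _ _ _ _ _ _ _ _ _ _ _ forceG); pattern_cases.
by apply/eqP=> /set2_eq[[]|[]].
Qed.

Theorem theorem6 (G : sgraph)
    (hC4 : ~ has_induced (cycle_graph 4) G)
    (hC5 : ~ has_induced (cycle_graph 5) G) :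
  forcing directed_paths G <-> comb G.
Proof.
split=> [forceG|combG D DG].
  split=> //; [exact: forcing_2K2_free|exact: forcing_chair_free|].
  exact: forcing_cochair_free.
have combD := comb_missing DG combG; apply: acyclic_directed_paths.
- exact: dependency_functional.
- exact: dependency_injective.
- exact: dependency_acyclic.
Qed.
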